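(* For every $0<\delta<\tfrac14$ there exist constants $c$ and $0<\rho<1$, depending only on $\delta$, such that the following holds. Let $(S_{i,j})_{1\le i\le j}$ be an array of real-valued random variables that is stationary, i.e. for every $m\in\mathbb N$ the arrays $(S_{i,j})_{1\le i\le j}$ and $(S_{i+m,j+m})_{1\le i\le j}$ have the same distribution. Let $s<t$ be real numbers. Then for every positive integer $k$, $$\mathbb P\big((S_{1,n})_{n=1}^\infty \text{ has } k \text{ upcrossings of } [s,t]\big)\ \le\ c\cdot\rho^k+\mathbb P(E_k),$$ where $E_k$ is the event that there exists $n>k$ such that $S_{1,n}>t$ and $[1;n]$ can be $\delta$-filled by pairwise disjoint intervals $V_1,\dots,V_r$ satisfying $S_{V_j}<s$ for every $j=1,\dots,r$.
   Context: For integers $i\le j$, $[i;j]=[i,j]\cap\mathbb N$ denotes the integer interval; ''interval'' means a set of this form. For $U=[i;j]$ write $S_U=S_{i,j}$. A sequence $(x_n)_{n=1}^\infty$ of real numbers has $k$ upcrossings of $[s,t]$ if there are indices $1\le i_1<j_1<i_2<j_2<\cdots<i_k<j_k$ such that $x_{i_m}<s$ and $x_{j_m}>t$ for $m=1,\dots,k$. A collection of intervals $I_1,\dots,I_r$ $\delta$-fills an interval $I$ if all $I_i$ are contained in $I$ and $|I\setminus\bigcup_i I_i|<\delta|I|$, where $|\cdot|$ denotes cardinality. *)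

(* Defs.v *)
From HB Require Import structures.
From mathcomp Require Import all_boot all_order all_algebra.
From mathcomp Require Import finmap.
From mathcomp Require Import all_classical all_reals all_analysis.
Set Implicit Arguments.
Unset Strict Implicit.
Unset Printing Implicit Defensive.
Import Order.TTheory GRing.Theory Num.Theory.
Local Open Scope classical_set_scope.
Local Open Scope ring_scope.

(* Only the coordinates (i, j) with 1 <= i <= j belong to an array: the sets of
   this sigma-algebra, on all functions nat -> nat -> R, depend on no others. *)
Definition array_measurable (R : realType) : set (set (nat -> nat -> R)) :=
  <<s [set A | exists (i j : nat) (B : set R),
         [/\ (1 <= i <= j)%N, measurable B & A = [set x | B (x i j)]] ]>>.

Definition same_array_law d (T : measurableType d) (R : realType)
    (P : probability T R) (X Y : nat -> nat -> T -> R) :=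
  forall A : set (nat -> nat -> R), array_measurable A ->
    P [set w | A (fun i j => X i j w)] = P [set w | A (fun i j => Y i j w)].

Definition stationary d (T : measurableType d) (R : realType)
    (P : probability T R) (S : nat -> nat -> T -> R) :=
  forall m : nat, same_array_law P S (fun i j => S (i + m)%N (j + m)%N).

(* Sequences and indices start at 1: x 0, a 0 and b 0 are never used. *)
Definition has_upcrossings (R : realType) (x : nat -> R) (s t : R) (k : nat) :=
  exists a b : nat -> nat,
    [/\ (1 <= a 1)%N,
        forall m, (1 <= m <= k)%N -> (a m < b m)%N,
        forall m, (1 <= m < k)%N -> (b m < a m.+1)%N &
        forall m, (1 <= m <= k)%N -> x (a m) < s /\ t < x (b m)].

Definition nat_itv (i j : nat) : {fset nat} :=
  [fset x in index_iota i j.+1]%fset.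

Definition fills (R : realType) (delta : R) (r : nat) (V : 'I_r -> {fset nat})
    (I : {fset nat}) :=
  (forall l, V l `<=` I)%fset /\
  (#|` I `\` \bigcup_(l in 'I_r) V l |%fset%:R < delta * #|` I |%fset%:R).

(* The intervals are V_l = [a l; b l], so that S_{V_l} is x (a l) (b l). *)
Definition has_low_filling (R : realType) (x : nat -> nat -> R) (delta s : R)
    (n : nat) :=
  exists (r : nat) (a b : 'I_r -> nat),
    [/\ forall l, (a l <= b l)%N,
        forall l l', l != l' ->
          [disjoint nat_itv (a l) (b l) & nat_itv (a l') (b l')]%fset,
        fills delta (fun l => nat_itv (a l) (b l)) (nat_itv 1 n) &
        forall l, x (a l) (b l) < s].

Definition event_E (R : realType) (T : Type) (S : nat -> nat -> T -> R)
    (delta s t : R) (k : nat) : set T :=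
  [set w | exists n, [/\ (k < n)%N, t < S 1%N n w &
                         has_low_filling (fun i j => S i j w) delta s n]].

(* Main.v *)
Require Import Defs.
From HB Require Import structures.
From mathcomp Require Import all_boot all_order all_algebra.
From mathcomp Require Import finmap.
From mathcomp Require Import all_classical all_reals all_analysis.
From mathcomp Require Import measurable_realfun.
From mathcomp Require Import ring lra zify.
Import Order.TTheory GRing.Theory Num.Theory.

(** Fix an outcome, hence an array, and call a position [i] bad when the array
started at [i] makes its [k] upcrossings within some bound [M] while no interval
of length at most [M] starting at [i] realises [E_k].  By stationarity the
probability of a bad start at 1 is the expected proportion of bad positions
among [N] consecutive ones, so it is enough to show, for every single array,
that this proportion is exponentially small in [k] ([bad_starts_count]).
Letting [M] grow and adding the probability of [E_k] then gives the theorem.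

The count is a Vitali-type argument with intervals anchored at their left
endpoints.  Every bad [i] carries nested intervals, alternately low (value
below [s]) and high (value above [t]).  Once its length exceeds [k], a high
interval is not delta-filled by low ones; applied to the single low interval
just below it, this makes the lengths grow by a factor [1 / (1 - delta)] per
upcrossing.  Now consider a family of disjoint low intervals whose left endpoints are
bad.  Replace them by longer high intervals at the same left endpoints, chosen greedily from left to right so that they are disjoint
and cover all the old endpoints.  Low intervals inside a high one occupy at
most [1 - delta] of it, so the total length must grow by a definite factor.
Going on from high to low loses almost nothing, hence one round multiplies the
total length by at least [1 + delta / 4] ([ladder_growth]).  All intervals lie
in a window of length [N + M], so few bad positions can exist to start with.

The difficulty is the old interval that straddles the right end of a new one:
it is harmless if it is at most [eps] times as long as the new one, but the
lengths at different positions are unrelated.  So each endpoint is offered [Q]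
consecutive candidate lengths, and is dropped only if all [Q] are spoiled.  An
old interval [U] of length [l] spoils a candidate at [i] only if [i] lies
within [l / eps] to the left of [U]; and if it spoils [e + 1] candidates at
[i], geometric growth forces [i] to lie within [(1 - delta)^e l / eps].
Summing over [e], [U] spoils candidates of total weight at most
[l / (eps * delta)] ([blocked_weight]), so by Markov's inequality the dropped
endpoints carry a fraction at most [1 / (Q * eps * delta)] of the total length.
As [Q] depends on [delta] only, [k] upcrossings allow a number of rounds
proportional to [k], which is what makes the bound exponential. *)

Set Implicit Arguments.
Unset Strict Implicit.
Unset Printing Implicit Defensive.
Local Open Scope ring_scope.

(** * Disjoint intervals with prescribed left endpoints *)

(** A family of intervals is encoded by the set [B] of its left endpoints and a
length function [l]: the intervals are [[i, i + l i)] for [i] in [B]. *)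
Definition spaced N (B : {set 'I_N}) (l : 'I_N -> nat) :=
  forall i j, i \in B -> j \in B -> (i < j)%N -> (i + l i <= j)%N.

Lemma spacedS N (B C : {set 'I_N}) l :
  C \subset B -> spaced B l -> spaced C l.
Proof. by move=> /fintype.subsetP sCB sep i j /sCB iB /sCB jB; exact: sep. Qed.

Lemma packing N (B : {set 'I_N}) l a b : spaced B l ->
  (forall i, i \in B -> (a <= i)%N /\ (i + l i <= b)%N) ->
  (\sum_(i in B) l i <= b - a)%N.
Proof.
elim: {B}#|B| {-2}B (leqnn #|B|) b => [|n IH] B.
  by rewrite leqn0 cards_eq0 => /eqP-> b _ _; rewrite big_set0.
move=> cB b sep inB; have [->|[i0 i0B]] := set_0Vmem B; first by rewrite big_set0.
pose i := [arg max_(i > i0 in B) (i : nat)].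
have [iB imax] : i \in B /\ forall j, j \in B -> (j <= i)%N.
  by rewrite /i; case: arg_maxnP.
have [ai ib] := inB _ iB.
have le1 : (\sum_(j in B :\ i) l j <= i - a)%N.
  apply: IH.
  - by rewrite (cardsD1 i) iB ltnS in cB.
  - by apply: spacedS sep; exact: finset.subsetDl.
  - move=> j /setD1P[ji jB]; split; first by have [] := inB _ jB.
    by apply: sep => //; rewrite ltn_neqAle imax // andbT.
rewrite (big_setD1 i) //=; apply: leq_trans (leq_add (leqnn _) le1) _.
by clearbody i; lia.
Qed.

(** Scanning from left to right and taking the interval at each point not yet
covered gives disjoint intervals that cover all of [G]: intervals anchored at
their left endpoints need no enlargement, unlike in Vitali's lemma. *)
Lemma greedy_cover N (G : {set 'I_N}) (v : 'I_N -> nat) :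
  (forall i, i \in G -> 0 < v i)%N ->
  exists2 H : {set 'I_N}, H \subset G & spaced H v /\
    (forall i, i \in G -> exists2 h, h \in H & (h <= i < h + v h)%N).
Proof.
elim: {G}#|G| {-2}G (leqnn #|G|) => [|n IH] G.
  rewrite leqn0 cards_eq0 => /eqP-> _; exists finset.set0 => //.
  by split=> [i j|i]; rewrite inE.
move=> cG vpos; have [G0|[i0 i0G]] := set_0Vmem G.
  by exists finset.set0; rewrite ?finset.sub0set //; split=> [i j|i]; rewrite ?G0 inE.
pose i := [arg min_(i < i0 in G) (i : nat)].
have [iG imin] : i \in G /\ forall j, j \in G -> (i <= j)%N.
  by rewrite /i; case: arg_minnP.
pose G1 := [set j in G | i + v i <= j]%N.
have [||H1 /fintype.subsetP sH1 [sep1 cov1]] := IH G1.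
- rewrite -ltnS; apply: leq_trans cG; apply: proper_card; apply/properP.
  split; first by apply/fintype.subsetP => j; rewrite inE => /andP[].
  by exists i; rewrite // inE iG /= -ltnNge; have := vpos _ iG; lia.
- by move=> j; rewrite inE => /andP[/vpos].
exists (i |: H1).
  apply/fintype.subsetP => j /setU1P[->//|/sH1]; by rewrite inE => /andP[].
split.
  move=> j j' /setU1P[->|jH] /setU1P[->|jH'].
  - by rewrite ltnn.
  - by move=> _; move/sH1: jH'; rewrite inE => /andP[].
  - by move/sH1: jH; rewrite inE => /andP[/imin]; lia.
  - exact: sep1.
move=> j jG; have [le|lt] := leqP (i + v i) j.
  have [|h hH ?] := cov1 j; first by rewrite inE jG.
  by exists h; rewrite // inE hH orbT.
by exists i; rewrite ?setU11 // imin.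
Qed.

Lemma spread_set Q (S : {set 'I_Q}) e : (e < #|S|)%N ->
  exists j0 j1, [/\ j0 \in S, j1 \in S & (j0 + e <= j1)%N].
Proof.
move=> eS; have /card_gt0P[i0 i0S] : (0 < #|S|)%N by lia.
pose j0 := [arg min_(i < i0 in S) (i : nat)].
have [j0S j0min] : j0 \in S /\ forall j, j \in S -> (j0 <= j)%N.
  by rewrite /j0; case: arg_minnP.
have [/exists_inP[j1 j1S le]|] := boolP [exists j1 in S, j0 + e <= j1]%N.
  by exists j0, j1.
rewrite negb_exists_in => /forall_inP far.
have : (#|S| <= e)%N.
  rewrite cardE -(size_map (fun i : 'I_Q => i : nat)) -(size_iota j0 e).
  apply: uniq_leq_size; first by rewrite map_inj_uniq ?enum_uniq //; exact: val_inj.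
  move=> _ /mapP[j /[!mem_enum] jS ->]; rewrite mem_iota j0min //=.
  by have := far _ jS; rewrite -ltnNge.
by lia.
Qed.

Lemma geometric_bound (R : realFieldType) (d : R) Q : 0 < d -> d < 1 ->
  \sum_(e < Q) (1 - d) ^+ e <= d^-1.
Proof.
move=> d0 d1; rewrite -[leRHS]mul1r ler_pdivlMr // mulrC.
have := subrX1 (1 - d) Q; rewrite addrAC subrr add0r mulNr => geo.
have -> : d * \sum_(e < Q) (1 - d) ^+ e = 1 - (1 - d) ^+ Q.
  by apply: oppr_inj; rewrite -geo opprB.
by rewrite gerBl exprn_ge0 // subr_ge0 ltW.
Qed.

Lemma geometric_chain (R : realFieldType) (d : R) Q (u : nat -> nat) j m :
  0 < d -> d < 1 ->
  (forall j, (j.+1 < Q)%N -> (u j)%:R <= (1 - d) * (u j.+1)%:R) ->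
  (j + m < Q)%N -> (u j)%:R <= (1 - d) ^+ m * (u (j + m)%N)%:R.
Proof.
move=> d0 d1 grow; elim: m => [|m IH] jm; first by rewrite addn0 mul1r.
apply: (le_trans (IH _)); first by lia.
rewrite exprSr -mulrA ler_wpM2l ?exprn_ge0 ?subr_ge0 ?(ltW d1) // addnS.
by apply: grow; lia.
Qed.

(** * One step: replacing a family by longer intervals *)

(** The candidate [[i, i + n)] is spoiled by the interval at [i1].  The last
conjunct lets short straddling intervals pass: they cost little. *)
Definition blocked N (R : realFieldType) (eps : R) (B : {set 'I_N})
    (l : 'I_N -> nat) (i i1 : 'I_N) (n : nat) :=
  [&& i1 \in B, (i < i1 < i + n)%N, (i + n < i1 + l i1)%N &
      eps * n%:R < (l i1)%:R].

Section Step.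
Variables (R : realFieldType) (d eps : R) (N Q : nat).
Variables (B : {set 'I_N}) (l : 'I_N -> nat) (v : 'I_N -> nat -> nat).
Hypotheses (d_gt0 : 0 < d) (d_lt1 : d < 1) (eps_gt0 : 0 < eps).
Hypothesis sepB : spaced B l.
Hypothesis v_grow : forall i, i \in B -> forall j, (j.+1 < Q)%N ->
  (v i j)%:R <= (1 - d) * (v i j.+1)%:R.

Let blocks i i1 := [set j : 'I_Q | blocked eps B l i i1 (v i j)].

(** If [i1] blocks more than [e] candidates at [i], the smallest of them reaches
[i1] while the largest is shorter than [l i1 / eps], so that [i] is within
[(1 - d) ^+ e * (l i1 / eps)] of [i1].  Disjoint intervals located there have
at most this total length; sum the geometric series over [e]. *)
Lemma blocked_weight i1 : i1 \in B ->
  \sum_(i in B) (l i)%:R * #|blocks i i1|%:R <= (l i1)%:R / (eps * d).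
Proof.
move=> i1B.
(* Layer cake: a count is the sum over [e] of the indicators of [e < count]. *)
have layer e : \sum_(i in B | (e < #|blocks i i1|)%N) (l i)%:R
    <= (1 - d) ^+ e * ((l i1)%:R / eps).
  pose C := [set i in B | (e < #|blocks i i1|)%N].
  rewrite -natr_sum.
  have -> : (\sum_(i in B | (e < #|blocks i i1|)%N) l i = \sum_(i in C) l i)%N.
    by apply: eq_bigl => i; rewrite inE.
  have [->|[c cC]] := set_0Vmem C.
    by rewrite big_set0 mulr_ge0 ?exprn_ge0 ?divr_ge0 ?subr_ge0 // ltW.
  (* The leftmost such endpoint bounds the stretch in which all of them lie. *)
  pose i0 := [arg min_(i < c in C) (i : nat)].
  have [i0C i0min] : i0 \in C /\ forall i, i \in C -> (i0 <= i)%N.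
    by rewrite /i0; case: arg_minnP.
  have CB i : i \in C -> i \in B /\ exists j0 j1 : 'I_Q,
    [/\ (i < i1 < i + v i j0)%N, eps * (v i j1)%:R < (l i1)%:R & (j0 + e <= j1)%N].
    rewrite inE => /andP[iB /spread_set[j0 [j1 [+ + j01]]]].
    rewrite !inE => /and4P[_ + _ _] /and4P[_ _ _ ?].
    by split=> //; exists j0, j1.
  have sepC : spaced C l.
    by apply: spacedS sepB; apply/fintype.subsetP => i /CB[].
  have inC i : i \in C -> (i0 <= i)%N /\ (i + l i <= i1)%N.
    move=> iC; split; first exact: i0min.
    by have [iB [j0 [_ [/andP[? _] _ _]]]] := CB _ iC; exact: sepB.
  have := packing sepC inC; rewrite -(ler_nat R) => /le_trans; apply.
  have [i0B [j0 [j1 [/andP[_ i1v] epsv j01]]]] := CB _ i0C.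
  have : (i1 - i0 <= v i0 j0)%N by lia.
  rewrite -(ler_nat R) => /le_trans; apply.
  have := @geometric_chain R d Q (v i0) j0 (j1 - j0) d_gt0 d_lt1 (v_grow i0B).
  rewrite subnKC; last by lia.
  move=> /(_ (ltn_ord _)) /le_trans; apply.
  apply: ler_pM; rewrite ?exprn_ge0 ?subr_ge0 ?ler0n ?(ltW d_lt1) //.
    by rewrite ler_wiXn2l ?subr_ge0 ?(ltW d_lt1) ?gerBl ?ltW //; lia.
  by rewrite ler_pdivlMr // mulrC ltW.
have cardE i : #|blocks i i1|%:R = \sum_(e < Q) ((e < #|blocks i i1|)%N : nat)%:R :> R.
  have le : (#|blocks i i1| <= Q)%N.
    by have := max_card (mem (blocks i i1)); rewrite card_ord.
  rewrite -[LHS]mulr1 mulr_natl -[in LHS](card_ord #|blocks i i1|) -sumr_const.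
  rewrite (big_ord_widen _ (fun=> 1) le) big_mkcond /=.
  by apply: eq_bigr => e _; case: ifP.
under eq_bigr do rewrite cardE mulr_sumr.
rewrite exchange_big /=.
apply: (@le_trans _ _ (\sum_(e < Q) (1 - d) ^+ e * ((l i1)%:R / eps))).
  apply: ler_sum => e _; apply: le_trans (layer e).
  rewrite big_mkcondr /=; apply: ler_sum => i _.
  by case: ifP => _; rewrite ?mulr1 ?mulr0.
rewrite -mulr_suml; have -> : (l i1)%:R / (eps * d) = d^-1 * ((l i1)%:R / eps).
  by rewrite [RHS]mulrC -mulrA -invfM.
by rewrite ler_wpM2r ?divr_ge0 ?geometric_bound // ?(ltW eps_gt0).
Qed.

Let trapped i := [forall j : 'I_Q, exists i1, j \in blocks i i1].

(** Markov's inequality for the number of blocked candidates, weighted by [l]: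
a trapped endpoint has all its [Q] candidates blocked. *)
Lemma trapped_weight :
  Q%:R * \sum_(i in B | trapped i) (l i)%:R <= (\sum_(i in B) (l i)%:R) / (eps * d).
Proof.
have count i : trapped i -> (Q <= \sum_(i1 in B) #|blocks i i1|)%N.
  move=> /forallP tr; rewrite -[leqLHS]card_ord -sum1_card.
  under [leqRHS]eq_bigr do rewrite -sum1_card big_mkcond /=.
  rewrite exchange_big /=; apply: leq_sum => j _.
  have /existsP[i1 ji1] := tr j.
  rewrite (bigD1 i1) /=; last by move: ji1; rewrite inE => /and4P[].
  by rewrite ji1.
rewrite mulr_suml mulr_sumr.
apply: (@le_trans _ _ (\sum_(i1 in B) \sum_(i in B) (l i)%:R * #|blocks i i1|%:R)).
  rewrite exchange_big [leRHS](bigID trapped) /= -[leLHS]addr0 lerD //.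
    apply: ler_sum => i /andP[_ tr].
    by rewrite -mulr_sumr mulrC ler_wpM2l // -natr_sum ler_nat count.
  by apply: sumr_ge0 => i _; apply: sumr_ge0 => i1 _; rewrite mulr_ge0.
by apply: ler_sum => i1; exact: blocked_weight.
Qed.

(** The number [theta] bounds the density of the old family inside a candidate:
it is 1 in general and [1 - delta] when low intervals cannot fill the
candidate.  Old intervals at endpoints that are not trapped start in some
chosen new interval [V]; those inside [V] have total length at most [theta |V|],
and the only other one straddles the right end of [V] and, as nothing blocks
[V], has length at most [eps |V|]. *)
Lemma growth_step (theta : R) : (0 < Q)%N ->
  (forall i, i \in B -> 0 < l i)%N ->
  (forall i j, i \in B -> (j < Q)%N -> l i <= v i j)%N ->
  (forall i j, i \in B -> (j < Q)%N ->
    \sum_(i1 in B | (i <= i1)%N && (i1 + l i1 <= i + v i j)%N) (l i1)%:R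
      <= theta * (v i j)%:R) ->
  exists (B' : {set 'I_N}) (f : 'I_N -> nat),
    [/\ B' \subset B, forall i, i \in B' -> (f i < Q)%N,
        spaced B' (fun i => v i (f i)) &
        (1 - (Q%:R * (eps * d))^-1) * \sum_(i in B) (l i)%:R
          <= (theta + eps) * \sum_(i in B') (v i (f i))%:R].
Proof.
move=> Q_gt0 l_gt0 le_lv inside.
pose free i (j : 'I_Q) := [forall i1, j \notin blocks i i1].
pose f i : nat := odflt (Ordinal Q_gt0) [pick j | free i j].
have fQ i : (f i < Q)%N by rewrite /f; exact: ltn_ord.
have freeP i : ~~ trapped i -> forall i1, ~~ blocked eps B l i i1 (v i (f i)).
  rewrite negb_forall => /existsP[j]; rewrite negb_exists => jfree i1.
  rewrite /f; case: pickP => [j' /forallP/(_ i1)|/(_ j)]; last by rewrite /free jfree.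
  by rewrite inE.
pose G := [set i in B | ~~ trapped i].
have [|H sHG [sepH covH]] := @greedy_cover N G (fun i => v i (f i)).
  move=> i; rewrite inE => /andP[iB _].
  by apply: leq_trans (l_gt0 _ iB) _; exact: le_lv.
exists H, f; split => //.
  by apply: fintype.subset_trans sHG _; apply/fintype.subsetP => i; rewrite inE => /andP[].
have HB i : i \in H -> i \in B by move/(fintype.subsetP sHG); rewrite inE => /andP[].
apply: (@le_trans _ _ (\sum_(i in G) (l i)%:R)).
  rewrite mulrBl mul1r lerBlDr.
  have -> : \sum_(i in G) (l i)%:R = \sum_(i in B | ~~ trapped i) (l i)%:R :> R.
    by apply: eq_bigl => i; rewrite inE.
  rewrite [leLHS](bigID trapped) /= addrC lerD2l.
  rewrite invfM -mulrA ler_pdivlMl ?ltr0n // mulrC [leRHS]mulrC mulrC.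
  exact: trapped_weight.
apply: (@le_trans _ _ (\sum_(h in H) \sum_(i in B | (h <= i < h + v h (f h))%N) (l i)%:R)).
  rewrite (exchange_big_dep (mem B)) /=; last by move=> h i _ /andP[].
  rewrite [leRHS](bigID (fun i => ~~ trapped i)) /= -[leLHS]addr0 lerD //.
    under eq_bigl do rewrite inE.
    apply: ler_sum => i iG; have [|h hH cov] := covH i; first by rewrite inE.
    rewrite (bigD1 h) /=; last by rewrite hH; case/andP: iG => ->.
    by rewrite lerDl sumr_ge0.
  by apply: sumr_ge0 => i _; apply: sumr_ge0.
rewrite mulr_sumr; apply: ler_sum => h hH; rewrite mulrDl.
have hB := HB _ hH.
rewrite (bigID (fun i : 'I_N => i + l i <= h + v h (f h))%N) /= lerD //.
  apply: le_trans (inside _ _ hB (fQ h)).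
  rewrite [leRHS]big_mkcond [leLHS]big_mkcond; apply: ler_sum => i _.
  by case: (i \in B); case: (h <= i)%N; case: (i + l i <= _)%N; 
     case: (i < _)%N; rewrite //= ?ler0n.
(* What remains is the straddling interval; spacing makes it unique. *)
set P := (X in \sum_(i | X i) _).
have [i /andP[/andP[iB /andP[hi iv]] iout]|none] := pickP P; last first.
  by rewrite big_pred0 // mulr_ge0 // ltW.
rewrite (bigD1 i) /=; last by rewrite /P iB hi iv iout.
rewrite big1 ?addr0; last first.
  move=> j /andP[/andP[/andP[jB /andP[hj jv]] jout] ji].
  have [ij|ij|/val_inj ij] := ltngtP i j.
  - by have := sepB iB jB ij; lia.
  - by have := sepB jB iB ij; lia.
  - by rewrite ij eqxx in ji.
have lth : (h < i)%N.
  rewrite ltn_neqAle hi andbT; apply: contra iout => /eqP/val_inj <-.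
  by rewrite leq_add2l le_lv.
have := freeP h; have := fintype.subsetP sHG _ hH; rewrite inE => /andP[_ ntr].
move=> /(_ ntr i); rewrite /blocked iB lth iv /= ltnNge iout /= -leNgt.
by [].
Qed.
End Step.

(** * Many steps: the total length grows exponentially *)

(** The two steps of one round, high to low and low to high, use [eps = d / 4]
and lose a fraction [K <= d / 8] each; the claim is then the inequality
[(1 + d/4)^2 (1 - 3d/4) <= (1 - d/8)^2]. *)
Lemma two_step_gain (R : realFieldType) (d K X W0 W1 W2 : R) :
  0 <= d -> d <= 1 -> K <= d / 8 -> 0 <= W0 -> 0 <= W1 -> 0 <= W2 -> X <= W0 ->
  (1 - K) * W0 <= (1 + d / 4) * W1 -> (1 - K) * W1 <= (1 - d + d / 4) * W2 ->
  (1 + d / 4) * X <= W2.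
Proof.
move=> d0 d1 Kd W0_ge0 W1_ge0 W2_ge0 XW W01 W12.
have bound W : 0 <= W -> (1 - d / 8) * W <= (1 - K) * W.
  by move=> ?; rewrite ler_wpM2r //; lra.
have {}W01 := le_trans (bound _ W0_ge0) W01.
have {}W12 := le_trans (bound _ W1_ge0) W12.
have h1 : (1 - d / 8) * ((1 - d / 8) * W0) <= (1 - d / 8) * ((1 + d / 4) * W1).
  by rewrite ler_wpM2l //; lra.
have h2 : (1 + d / 4) * ((1 - d / 8) * W1) <= (1 + d / 4) * ((1 - d + d / 4) * W2).
  by rewrite ler_wpM2l //; lra.
have h3 : (1 - d / 4) * W0 <= (1 - d / 8) * ((1 - d / 8) * W0).
  by rewrite mulrA ler_wpM2r //; have := sqr_ge0 d; rewrite expr2; lra.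
have h4 : (1 + d / 4) * ((1 - d + d / 4) * W2) <= (1 - d / 2) * W2.
  by rewrite mulrA ler_wpM2r //; have := sqr_ge0 d; rewrite expr2; lra.
rewrite -(ler_pM2l (_ : 0 < 1 - d / 2)); last by lra.
apply: (@le_trans _ _ ((1 - d / 4) * W0)); last by lra.
rewrite mulrA; apply: (@le_trans _ _ ((1 - d / 2) * (1 + d / 4) * W0)).
  by rewrite ler_wpM2l // mulr_ge0 //; lra.
by rewrite ler_wpM2r //; have := sqr_ge0 d; rewrite expr2; lra.
Qed.

(** The geometric growth of the lengths need not be assumed: it follows from
[unfilled] applied to one low interval. *)
Section Ladder.
Variables (R : realFieldType) (d : R) (N M L Q : nat) (A : {set 'I_N}).
Variables (a b : 'I_N -> nat -> nat) (low : 'I_N -> nat -> Prop).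
Hypotheses (d_gt0 : 0 < d) (d_lt1 : d < 1) (Q_large : 32 / d ^+ 3 <= Q%:R).
Hypothesis M_gt0 : (0 < M)%N.
Hypothesis a_gt0 : forall i m, i \in A -> (m < L)%N -> (0 < a i m)%N.
Hypothesis ab_le : forall i m, i \in A -> (m < L)%N -> (a i m <= b i m)%N.
Hypothesis ba_le : forall i m, i \in A -> (m.+1 < L)%N -> (b i m <= a i m.+1)%N.
Hypothesis b_le : forall i m, i \in A -> (m < L)%N -> (b i m <= M)%N.
Hypothesis a_low : forall i m, i \in A -> (m < L)%N -> low i (a i m).
Hypothesis unfilled : forall i m (C : {set 'I_N}) l, i \in A -> (m < L)%N ->
  spaced C l -> (forall j, j \in C -> 0 < l j)%N ->
  (forall j, j \in C -> low j (l j)) ->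
  (forall j, j \in C -> (i <= j)%N /\ (j + l j <= i + b i m)%N) ->
  \sum_(j in C) (l j)%:R <= (1 - d) * (b i m)%:R.

Let ab_grow i m : i \in A -> (m < L)%N ->
  (a i m)%:R <= (1 - d) * (b i m)%:R.
Proof.
move=> iA mL; have := @unfilled i m [set i] (fun=> a i m) iA mL.
rewrite big_set1; apply=> [j j'|j|j|j]; rewrite !inE.
- by move=> /eqP-> /eqP->; rewrite ltnn.
- by move=> _; exact: a_gt0.
- by move=> /eqP->; exact: a_low.
- by move=> /eqP->; rewrite leqnn leq_add2l ab_le.
Qed.

Let a_homo i m m' : i \in A -> (m <= m')%N -> (m' < L)%N -> (a i m <= a i m')%N.
Proof.
move=> iA; elim: m' => [|m' IH]; first by rewrite leqn0 => /eqP->.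
rewrite leq_eqVlt => /orP[/eqP->//|]; rewrite ltnS => mm' m'L.
apply: leq_trans (IH mm' (ltnW m'L)) _.
by apply: leq_trans (ba_le iA m'L); apply: ab_le => //; exact: ltnW.
Qed.

(** A round uses [Q] low and [Q] high lengths at each endpoint.  The invariant
keeps the current lengths below the low lengths of all later rounds, so that
the step lemma applies again; unit intervals at the points of [A] start the
induction. *)
Lemma ladder_growth T : (T * (Q + Q) <= L)%N ->
  exists (B : {set 'I_N}) (l : 'I_N -> nat),
    [/\ B \subset A, spaced B l,
        forall i, i \in B -> (0 < l i <= M)%N,
        forall i m, i \in B -> (T * (Q + Q) <= m)%N -> (m < L)%N -> (l i <= a i m)%N &
        (1 + d / 4) ^+ T * #|A|%:R <= \sum_(i in B) (l i)%:R].
Proof.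
elim: T => [_|T IH TL].
  exists A, (fun=> 1%N); split=> //.
  - by move=> i j _ _; rewrite addn1.
  - by move=> i m iA _ mL; exact: a_gt0.
  - by rewrite mul1r -natr_sum sum1_card.
have {IH} [|B [l [sBA sepB l_itv l_le W]]] := IH; first by lia.
have BA i : i \in B -> i \in A by exact: (fintype.subsetP sBA).
have eps_gt0 : 0 < d / 4 by rewrite divr_gt0.
have Q_gt0 : (0 < Q)%N.
  by rewrite -(ltr_nat R); apply: lt_le_trans Q_large; rewrite divr_gt0 ?exprn_gt0.
have loss : (Q%:R * (d / 4 * d))^-1 <= d / 8.
  rewrite -[leRHS]invrK lef_pV2 ?posrE ?invr_gt0 ?mulr_gt0 ?ltr0n ?invr_gt0 ?ltr0n //.
  move: Q_large; rewrite ler_pdivrMr ?exprn_gt0 // invf_div ler_pdivrMr //.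
  by rewrite !exprS expr0; nra.
pose t := (T * (Q + Q))%N; have tQ : (t + Q + Q <= L)%N by clear -TL; lia.
have t1 j : (j < Q)%N -> (t + j < L)%N by clear -tQ; lia.
have t2 j : (j < Q)%N -> (t + Q + j < L)%N by clear -tQ; lia.
have t12 j j' : (j < Q)%N -> (t + j <= t + Q + j')%N by clear; lia.
pose v1 i j := a i (t + j)%N.
have [||||B1 [f1 [sB1 f1Q sep1 W1]]] :=
  @growth_step R d (d / 4) N Q B l v1 d_gt0 d_lt1 eps_gt0 sepB _ 1 Q_gt0.
- move=> i /BA iA j jQ; apply: le_trans (ab_grow _ _) _ => //; first exact/t1/ltnW.
  rewrite ler_wpM2l ?subr_ge0 ?(ltW d_lt1) // ler_nat /v1 addnS.
  by apply: ba_le => //; rewrite -addnS; exact: t1.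
- by move=> i /l_itv /andP[].
- by move=> i j iB jQ; apply: l_le => //; [exact: leq_addr|exact: t1].
- move=> i j iB jQ; rewrite mul1r -natr_sum ler_nat.
  rewrite -[leqRHS](addKn i).
  have := @packing _ [set i1 in B | (i <= i1)%N && (i1 + l i1 <= i + v1 i j)%N] l i (i + v1 i j).
  under eq_bigl do rewrite inE.
  apply=> [|i1]; last by rewrite inE => /andP[_ /andP[]].
  by apply: spacedS sepB; apply/fintype.subsetP => i1; rewrite inE => /andP[].
have B1A i : i \in B1 -> i \in A by move/(fintype.subsetP sB1)/BA.
pose v2 i j := b i (t + Q + j)%N.
have [||||B2 [f2 [sB2 f2Q sep2 W2]]] :=
  @growth_step R d (d / 4) N Q B1 _ v2 d_gt0 d_lt1 eps_gt0 sep1 _ (1 - d) Q_gt0.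
- move=> i /B1A iA j jQ; apply: (@le_trans _ _ (a i (t + Q + j.+1)%N)%:R).
    by rewrite ler_nat /v2 addnS; apply: ba_le => //; rewrite -addnS; exact: t2.
  by apply: ab_grow => //; exact: t2.
- by move=> i iB1; apply: a_gt0; [exact: B1A|by apply: t1; exact: f1Q].
- move=> i j iB1 jQ.
  apply: (@leq_trans (a i (t + Q + j)%N)).
    by apply: a_homo; [exact: B1A|by apply: t12; exact: f1Q|exact: t2].
  by apply: ab_le; [exact: B1A|exact: t2].
- move=> i j iB1 jQ.
  pose C := [set i1 in B1 | (i <= i1)%N && (i1 + v1 i1 (f1 i1) <= i + v2 i j)%N].
  have CB1 i1 : i1 \in C -> i1 \in B1 by rewrite inE => /andP[].
  have := @unfilled i (t + Q + j)%N C (fun i => v1 i (f1 i)).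
  under eq_bigl do rewrite inE; apply.
  + exact: B1A.
  + exact: t2.
  + by apply: spacedS sep1; apply/fintype.subsetP => i1 /CB1.
  + by move=> i1 /CB1 i1B; apply: a_gt0; [exact: B1A|by apply: t1; exact: f1Q].
  + by move=> i1 /CB1 i1B; apply: a_low; [exact: B1A|by apply: t1; exact: f1Q].
  + by move=> i1; rewrite inE => /andP[_ /andP[]].
exists B2, (fun i => v2 i (f2 i)); split=> //.
- by apply: fintype.subset_trans sB2 _; apply/fintype.subsetP => i /B1A.
- move=> i iB2; have iA : i \in A by apply: B1A; exact: (fintype.subsetP sB2).
  have f2L := t2 _ (f2Q _ iB2); apply/andP; split; last exact: b_le.
  exact: leq_trans (a_gt0 iA f2L) (ab_le iA f2L).
- move=> i m iB2 Tm mL; have iA : i \in A by apply: B1A; exact: (fintype.subsetP sB2).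
  have fm : (t + Q + f2 i < m)%N.
    by move: (f2Q _ iB2) Tm; rewrite mulSn -/t; clear; lia.
  apply: leq_trans (ba_le iA _) _; first exact: leq_ltn_trans fm mL.
  exact: a_homo.
rewrite exprS -mulrA; apply: (two_step_gain _ _ _ _ _ _ W W1 W2) => //.
- by rewrite ltW.
- by rewrite ltW.
- exact: sumr_ge0.
- exact: sumr_ge0.
- exact: sumr_ge0.
Qed.
End Ladder.

Local Open Scope classical_set_scope.

(** * Counting the bad starting points of an array *)

Lemma card_nat_itv i j : (i <= j.+1)%N -> #|` nat_itv i j| = (j.+1 - i)%N.
Proof. by move=> ij; rewrite /nat_itv card_fseq undup_id ?iota_uniq // size_iota. Qed.

Lemma mem_nat_itv i j p : (p \in nat_itv i j) = (i <= p <= j)%N.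
Proof. by rewrite /nat_itv !inE mem_index_iota. Qed.

Lemma card_bigfcup_disjoint (I : eqType) (K : choiceType) (r : seq I)
    (F : I -> {fset K}) : uniq r ->
  {in r &, forall i j, i != j -> [disjoint F i & F j]%fset} ->
  #|` (\bigcup_(i <- r) F i)%fset| = (\sum_(i <- r) #|` F i|)%N.
Proof.
elim: r => [|x r IH] /=; first by rewrite !big_nil cardfs0.
move=> /andP[xr ur] dis; rewrite !big_cons -IH //; last first.
  by move=> i j ir jr; apply: dis; rewrite inE ?ir ?jr orbT.
rewrite cardfsU; have /eqP-> : #|` F x `&` \bigcup_(i <- r) F i|%fset == 0%N.
  rewrite cardfs_eq0 -/(fdisjoint _ _) fdisjoint_sym.
  apply/fdisjointP => p /bigfcupP[i /andP[ir _] pi].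
  have /fdisjointP : [disjoint F i & F x]%fset; last exact.
  apply: dis; rewrite ?inE ?ir ?eqxx ?orbT //.
  by apply: contraNneq xr => <-.
by rewrite subn0.
Qed.

Definition shift_array (R : Type) m (y : nat -> nat -> R) :=
  fun i j => y (i + m)%N (j + m)%N.

(** The filling required by [has_low_filling] is enumerated from a family of low
intervals of [y], moved so that its window starts at 1. *)
Lemma low_fillingP (R : realType) (d s : R) N (C : {set 'I_N}) l (i n : nat)
    (y : nat -> nat -> R) :
  spaced C l -> (forall j, j \in C -> 0 < l j)%N ->
  (forall j, j \in C -> shift_array j y 1 (l j) < s) ->
  (forall j, j \in C -> (i <= j)%N /\ (j + l j <= i + n)%N) ->
  (1 - d) * n%:R < \sum_(j in C) (l j)%:R ->
  has_low_filling (shift_array i y) d s n.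
Proof.
move=> sep l_gt0 low inside big.
pose e (c : 'I_#|C|) : 'I_N := enum_val c.
have eC c : e c \in C by exact: enum_valP.
pose a c := ((e c - i).+1)%N; pose b c := (e c - i + l (e c))%N.
have ab c : (a c <= b c)%N by have := l_gt0 _ (eC c); rewrite /a /b; lia.
have dis c c' : c != c' -> [disjoint nat_itv (a c) (b c) & nat_itv (a c') (b c')]%fset.
  move=> cc'; have ee : e c != e c' by rewrite (inj_eq enum_val_inj).
  have [i1 h1] := inside _ (eC c); have [i2 h2] := inside _ (eC c').
  apply/fdisjointP => p; rewrite !mem_nat_itv /a /b.
  have [lt|lt|/val_inj/eqP] := ltngtP (e c) (e c'); last by rewrite (negbTE ee).
  - by have := sep _ _ (eC c) (eC c') lt; lia.
  - by have := sep _ _ (eC c') (eC c) lt; lia.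
exists #|C|, a, b; split => //.
- have sub c : (nat_itv (a c) (b c) `<=` nat_itv 1 n)%fset.
    have [i1 h1] := inside _ (eC c).
    by apply/fsubsetP => p; rewrite !mem_nat_itv /a /b; lia.
  split=> //; set U := (\bigcup_(l in _) _)%fset.
  have sU : (U `<=` nat_itv 1 n)%fset by apply/bigfcupsP => c _ _; exact: sub.
  have cU : #|` U| = (\sum_(j in C) l j)%N.
    rewrite /U card_bigfcup_disjoint ?index_enum_uniq //; last by move=> c c' _ _; exact: dis.
    rewrite [RHS](big_enum_val (fun j => l j)) /=.
    apply: eq_bigr => c _; rewrite card_nat_itv; last exact: leqW.
    by rewrite /a /b subSS addKn.
  rewrite cardfsDS // natrB ?fsubset_leq_card // cU card_nat_itv // subSS subn0.
  by rewrite natr_sum; lra.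
- move=> c; have := low _ (eC c); have [i1 _] := inside _ (eC c).
  rewrite /shift_array /a /b.
  by congr (y _ _ < s); lia.
Qed.

(** The bound [M] makes the events below depend on finitely many entries of the
array, and keeps all intervals inside a finite window. *)
Definition upcrosses_by (R : realType) (x : nat -> R) (s t : R) (k M : nat) :=
  exists a b : nat -> nat,
    [/\ (1 <= a 1)%N,
        forall m, (1 <= m <= k)%N -> (a m < b m)%N,
        forall m, (1 <= m < k)%N -> (b m < a m.+1)%N,
        forall m, (1 <= m <= k)%N -> x (a m) < s /\ t < x (b m) &
        (b k <= M)%N].

Definition low_filled_by (R : realType) (y : nat -> nat -> R) (d s t : R)
    (k M : nat) :=
  exists n, [/\ (k < n <= M)%N, t < y 1%N n & has_low_filling y d s n].

Definition bad_start (R : realType) (y : nat -> nat -> R) (d s t : R)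
    (k M : nat) :=
  upcrosses_by (y 1%N) s t k M /\ ~ low_filled_by y d s t k M.

Section Interlaced.
Variables (k : nat) (a b : nat -> nat).
Hypotheses (a1 : (1 <= a 1)%N)
  (ab : forall m, (1 <= m <= k)%N -> (a m < b m)%N)
  (ba : forall m, (1 <= m < k)%N -> (b m < a m.+1)%N).

(** This is what turns the index of an upcrossing into a length: beyond the index
[k / 2], high intervals are longer than [k], as the definition of [event_E]
demands. *)
Lemma interlaced_ge m : (1 <= m <= k)%N -> (m.*2 <= b m)%N.
Proof.
elim: m => // m IH; case: m IH => [_|m IH] mk; have := ab mk; first by lia.
by have := IH ltac:(lia); have := @ba m.+1 ltac:(lia); lia.
Qed.

Lemma interlaced_homo m m' : (1 <= m)%N -> (m <= m' <= k)%N -> (b m <= b m')%N.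
Proof.
move=> m1; elim: m' => [|m' IH]; first by lia.
have [->//|mm'] := eqVneq m m'.+1; move=> mk.
have := IH ltac:(lia); have := @ab m'.+1 ltac:(lia); have := @ba m' ltac:(lia).
by lia.
Qed.
End Interlaced.

(** The deterministic heart of the theorem.  Only the upcrossings with index above
[k / 2] are used, there are [uphalf k] of them; being longer than [k], their high
intervals cannot be filled by low intervals, for this would realise
[low_filled_by] at a bad point. *)
Lemma bad_starts_count (R : realType) (d s t : R) (k M N Q T : nat)
    (y : nat -> nat -> R) :
  0 < d -> d < 1 -> 32 / d ^+ 3 <= Q%:R -> (0 < k)%N -> (0 < M)%N ->
  (T * (Q + Q) <= uphalf k)%N ->
  (1 + d / 4) ^+ T * #|[set i : 'I_N | `[< bad_start (shift_array i y) d s t k M >]]%SET|%:R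
    <= (N + M)%:R.
Proof.
move=> d_gt0 d_lt1 Q_large k_gt0 M_gt0 TL; set A := [set i | _]%SET.
have /choice[w wP] (i : 'I_N) : exists ab : (nat -> nat) * (nat -> nat), i \in A ->
    [/\ (1 <= ab.1 1)%N,
        forall m, (1 <= m <= k)%N -> (ab.1 m < ab.2 m)%N,
        forall m, (1 <= m < k)%N -> (ab.2 m < ab.1 m.+1)%N,
        forall m, (1 <= m <= k)%N -> shift_array i y 1%N (ab.1 m) < s
           /\ t < shift_array i y 1%N (ab.2 m) &
        (ab.2 k <= M)%N].
  have [|iA] := boolP (i \in A); last by exists (id, id).
  by rewrite inE => /asboolP[[a [b H]] _]; exists (a, b).
pose a i m := (w i).1 (k./2.+1 + m)%N; pose b i m := (w i).2 (k./2.+1 + m)%N.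
pose low (i : 'I_N) n := shift_array i y 1%N n < s.
have half m : (m < uphalf k)%N -> (1 <= k./2.+1 + m <= k)%N.
  by rewrite uphalf_half; have := odd_double_half k; lia.
have ab_lt i m : i \in A -> (m < uphalf k)%N -> (a i m < b i m)%N.
  by move=> iA /half mk; have [_ + _ _ _] := wP _ iA; exact.
have [||||||B [l [_ sep l_itv _ W]]] :=
  @ladder_growth R d N M (uphalf k) Q A a b low d_gt0 d_lt1 Q_large M_gt0
  _ _ _ _ _ _ T TL.
- move=> i m iA /half mk; have [a1 ab ba _ _] := wP _ iA; rewrite /a.
  move: mk; case: (k./2 + m)%N (addSn k./2 m) => [->//|n ->] mk.
  by have := @ba n.+1 ltac:(lia); lia.
- by move=> i m iA mk; exact/ltnW/ab_lt.
- move=> i m iA /half mk; have [_ _ ba _ _] := wP _ iA.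
  by rewrite /a /b addnS; apply/ltnW/ba; move: mk; rewrite addnS.
- move=> i m iA /half mk; have [a1 ab ba _ bM] := wP _ iA.
  rewrite /b; apply: (leq_trans _ bM);
 apply: (interlaced_homo a1 ab ba); first by case/andP: mk.
  by case/andP: mk => _ ->; rewrite leqnn.
- move=> i m iA /half mk; have [_ _ _ up _] := wP _ iA.
  by have [] := up _ mk.
- move=> i m C l iA mL sep l_gt0 lowC inside; rewrite leNgt; apply/negP => big.
  move: (iA); rewrite inE => /asboolP[_]; apply.
  have mk := half _ mL; have [a1 ab ba up bM] := wP _ iA.
  exists (b i m); split.
  + apply/andP; split.
      have := interlaced_ge a1 ab ba mk; rewrite -/(b i m).
      by have := odd_double_half k; lia.
    rewrite /b; apply: (leq_trans _ bM);
 apply: (interlaced_homo a1 ab ba); first by case/andP: mk.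
    by case/andP: mk => _ ->; rewrite leqnn.
  + by have [] := up _ mk.
  + exact: low_fillingP sep l_gt0 lowC inside big.
apply: le_trans W _; rewrite -natr_sum ler_nat -[leqRHS]subn0.
apply: (packing sep) => i /l_itv /andP[_ lM]; split=> //.
by rewrite leq_add // ltnW.
Qed.

(** * Measurability *)

Definition same_signs (R : realType) (s t : R) M (y y' : nat -> nat -> R) :=
  forall i j, (1 <= i <= j)%N -> (j <= M)%N ->
    (y i j < s) = (y' i j < s) /\ (t < y i j) = (t < y' i j).

Lemma same_signs_sym (R : realType) (s t : R) M (y y' : nat -> nat -> R) :
  same_signs s t M y y' -> same_signs s t M y' y.
Proof. by move=> yy' i j ij jM; have [-> ->] := yy' i j ij jM. Qed.

Lemma upcrosses_by_signs (R : realType) (s t : R) k M (y y' : nat -> nat -> R) :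
  same_signs s t M y y' ->
  upcrosses_by (y 1%N) s t k M -> upcrosses_by (y' 1%N) s t k M.
Proof.
move=> yy' [a [b [a1 ab ba up bM]]]; exists a, b; split=> // m mk.
have [am bm] := up _ mk; have abm := ab _ mk.
have bmM : (b m <= M)%N.
  apply: leq_trans bM; apply: (interlaced_homo a1 ab ba); case/andP: mk => // _ ->.
  by rewrite leqnn.
have am0 : (1 <= a m)%N.
  move: mk {am bm abm bmM}; case: m => // -[//|m] mk.
  by have := @ba m.+1 mk; lia.
have [<- _] := yy' 1%N (a m) ltac:(lia) ltac:(lia).
by have [_ <-] := yy' 1%N (b m) ltac:(lia) ltac:(lia).
Qed.

Lemma low_filled_by_signs (R : realType) (d s t : R) k M (y y' : nat -> nat -> R) :
  same_signs s t M y y' -> low_filled_by y d s t k M -> low_filled_by y' d s t k M.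
Proof.
move=> yy' [n [nkM tn [r [a [b [ab dis [sub fill] low]]]]]].
have nM : (n <= M)%N by lia.
exists n; split=> //; first by have [_ <-] := yy' 1%N n ltac:(lia) nM.
exists r, a, b; split=> // c; have /fsubsetP sc := sub c.
have := sc (a c); have := sc (b c); rewrite !mem_nat_itv !leqnn ab /=.
move=> /(_ isT)/andP[_ bn] /(_ isT)/andP[a1 _].
by have [<- _] := yy' (a c) (b c) ltac:(by rewrite a1 ab) (leq_trans bn nM).
Qed.

Lemma bad_start_signs (R : realType) (d s t : R) k M (y y' : nat -> nat -> R) :
  same_signs s t M y y' -> bad_start y d s t k M -> bad_start y' d s t k M.
Proof.
move=> yy' [up nlow]; split; first exact: upcrosses_by_signs up.
by move=> low; apply/nlow/low_filled_by_signs/low/same_signs_sym.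
Qed.

Lemma array_measurable_coordinate (R : realType) i j (B : set R) :
  (1 <= i <= j)%N -> measurable B ->
  array_measurable [set x : nat -> nat -> R | B (x i j)].
Proof. by move=> ij mB; apply: sub_sigma_algebra; exists i, j, B. Qed.

Lemma measurable_sign_class (R : realType) (s t : R) (u : bool * bool) :
  measurable [set r : R | (r < s, t < r) = u].
Proof.
have lts : measurable [set r : R | (r < s) = u.1].
  case: u.1; first by rewrite -set_itvNyo; exact: measurable_itv.
  rewrite (_ : [set _ | _] = ~` `]-oo, s[); first exact: measurableC.
  by rewrite set_itvNyo; apply/seteqP; split=> r /= => [->|/negP/negbTE].
have ltt : measurable [set r : R | (t < r) = u.2].
  case: u.2; first by rewrite -set_itvoy; exact: measurable_itv.
  rewrite (_ : [set _ | _] = ~` `]t, +oo[); first exact: measurableC.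
  by rewrite set_itvoy; apply/seteqP; split=> r /= => [->|/negP/negbTE].
rewrite (_ : [set _ | _] = [set r | (r < s) = u.1] `&` [set r | (t < r) = u.2]).
  exact: measurableI.
by case: u {lts ltt} => u1 u2; apply/seteqP; split=> r /= [-> ->].
Qed.

(** There are finitely many sign patterns up to [M], and each is a finite
intersection of events on single entries. *)
Lemma signs_array_measurable (R : realType) (s t : R) M (A : set (nat -> nat -> R)) :
  (forall y y', same_signs s t M y y' -> A y -> A y') -> array_measurable A.
Proof.
move=> Asigns.
pose dom (p : 'I_M.+1 * 'I_M.+1) := (1 <= p.1 <= p.2)%N.
pose pat (y : nat -> nat -> R) := [ffun p : 'I_M.+1 * 'I_M.+1 =>
  if dom p then (y p.1 p.2 < s, t < y p.1 p.2) else (false, false)].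
have patP y y' : pat y = pat y' -> same_signs s t M y y'.
  move=> /ffunP pyy' i j ij jM.
  have iM : (i < M.+1)%N by lia.
  have := pyy' (Ordinal iM, Ordinal (jM : (j < M.+1)%N)).
  by rewrite !ffunE /dom /= ij => -[].
pose gen := [set A | exists (i j : nat) (B : set R),
  [/\ (1 <= i <= j)%N, measurable B & A = [set x : nat -> nat -> R | B (x i j)]] ].
(* Generated sigma-algebras are measurable types only over pointed types. *)
pose arrays : pointedType :=
  HB.pack (nat -> nat -> R) (gen_choiceMixin (nat -> nat -> R))
    (gen_eqMixin (nat -> nat -> R)) (isPointed.Build (nat -> nat -> R) (fun _ _ => 0)).
suff : measurable (A : set (@g_sigma_algebraType arrays gen)) by [].
rewrite (_ : A = \bigcup_(f in [set f | exists2 y, A y & pat y = f])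
    \bigcap_(p in [set: 'I_M.+1 * 'I_M.+1]) [set y | pat y p = f p]); last first.
  apply/seteqP; split=> [y Ay|y [_ [y' Ay' <-]] yy'].
    by exists (pat y) => //; exists y.
  by apply: Asigns Ay'; apply: patP; apply/ffunP => p; rewrite -yy'.
apply: fin_bigcup_measurable; first exact: finite_finset.
move=> f _; apply: fin_bigcap_measurable; first exact: finite_finset.
move=> p _; under eq_set do rewrite ffunE.
case: (boolP (dom p)) => dp.
  exact: (array_measurable_coordinate dp (measurable_sign_class s t (f p))).
have [ef|nf] := pselect ((false, false) = f p).
  by rewrite (_ : [set _ | _] = setT) //; apply/seteqP; split.
by rewrite (_ : [set _ | _] = set0) //; apply/seteqP; split.
Qed.

Lemma array_measurable_low_filled (R : realType) (d s t : R) k M :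
  array_measurable [set y : nat -> nat -> R | low_filled_by y d s t k M].
Proof.
by apply: (@signs_array_measurable R s t M) => y y'; exact: low_filled_by_signs.
Qed.

Lemma array_measurable_upcrosses (R : realType) (s t : R) k M :
  array_measurable [set y : nat -> nat -> R | upcrosses_by (y 1%N) s t k M].
Proof.
by apply: (@signs_array_measurable R s t M) => y y'; exact: upcrosses_by_signs.
Qed.

Lemma array_measurable_bad_start (R : realType) (d s t : R) k M :
  array_measurable [set y : nat -> nat -> R | bad_start y d s t k M].
Proof.
by apply: (@signs_array_measurable R s t M) => y y'; exact: bad_start_signs.
Qed.

Lemma array_measurable_event d (T : measurableType d) (R : realType)
    (P : probability T R) (S : nat -> nat -> {RV P >-> R})
    (A : set (nat -> nat -> R)) :
  array_measurable A -> measurable [set w | A (fun i j => S i j w)].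
Proof.
pose F w i j := S i j w.
suff : @array_measurable R `<=` image_set_system setT F measurable.
  by move=> sub /sub; rewrite /image_set_system /mkset setTI.
apply: smallest_sub.
  by apply: sigma_algebra_image; exact: sigma_algebra_measurable.
move=> _ [i [j [B [ij mB ->]]]]; rewrite /image_set_system /mkset setTI.
exact: (measurable_funPTI (S i j) mB).
Qed.

(** * From counting to probability *)

(** The sum of the probabilities is the expected number of events that occur. *)
Lemma probability_le_count d (T : measurableType d) (R : realType)
    (P : probability T R) N (F : 'I_N -> set T) (C : R) :
  (forall i, measurable (F i)) ->
  (forall w, #|[set i | `[< F i w >]]%SET|%:R <= C) ->
  (\sum_(i < N) P (F i) <= C%:E)%E.
Proof.
move=> mF count.
have C_ge0 : 0 <= C by apply: le_trans (count point); exact: ler0n.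
have mind i : measurable_fun setT (EFin \o \1_(F i) : T -> \bar R).
  by apply/measurable_EFinP; exact: measurable_indic.
have -> : (\sum_(i < N) P (F i) =
    \int[P]_(w in setT) \sum_(i < N) (\1_(F i) w)%:E)%E.
  rewrite ge0_integral_sum //.
    by apply: eq_bigr => i _; rewrite integral_indic // setIT.
have -> : C%:E = (\int[P]_(w in setT) (cst C%:E) w)%E.
  rewrite integral_cst // [X in (_ * X)%E](_ : _ = 1%E) ?mule1 //.
  exact: probability_setT.
apply: ge0_le_integral => //.
- by move=> w _; apply: sume_ge0.
- exact: emeasurable_sum.
move=> w _; rewrite sumEFin lee_fin; apply: le_trans (count w).
rewrite -sum1_card natr_sum [leRHS]big_mkcond /=; apply: ler_sum => i _.
rewrite inE indicE; have [Fw|nFw] := pselect (F i w).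
  by rewrite mem_set // asboolT.
by rewrite memNset // asboolF.
Qed.

(** By stationarity all positions in a window of length [M + 1] are bad with the
same probability; the factor 2 comes from the intervals of length up to [M] that
stick out of this window. *)
Lemma bad_start_probability (R : realType) (d s t : R) (k M Q j : nat)
    (disp : measure_display) (T : measurableType disp) (P : probability T R)
    (S : nat -> nat -> {RV P >-> R}) :
  stationary P S -> 0 < d -> d < 1 -> 32 / d ^+ 3 <= Q%:R -> (0 < k)%N ->
  (j * (Q + Q) <= uphalf k)%N ->
  (P [set w | bad_start (fun i j => S i j w) d s t k M]
    <= (2 * (1 + d / 4) ^- j)%:E)%E.
Proof.
move=> stat d_gt0 d_lt1 Q_large k_gt0 jk.
pose A : set (nat -> nat -> R) := [set y | bad_start y d s t k M].
have mA : array_measurable A by exact: array_measurable_bad_start.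
pose F (i : 'I_M.+1) : set T := [set w | A (shift_array i (fun i j => S i j w))].
have mF i : measurable (F i).
  exact: (array_measurable_event (fun i' j' => S (i' + i)%N (j' + i)%N) mA).
have PF i : P (F i) = P [set w | A (fun i j => S i j w)].
  by rewrite (stat i A mA).
have : P (F ord0) \is a fin_num by exact: fin_num_measure.
rewrite PF; set p := P _ => p_fin.
have pE : p = (fine p)%:E by rewrite fineK.
have growth_gt0 : 0 < (1 + d / 4) ^+ j by rewrite exprn_gt0 // addr_gt0 ?divr_gt0.
have := @probability_le_count _ _ _ P M.+1 F (M.+1%:R * (2 / (1 + d / 4) ^+ j)) mF.
have count w : #|[set i | `[< F i w >]]%SET|%:R <= M.+1%:R * (2 / (1 + d / 4) ^+ j).
  rewrite mulrA ler_pdivlMr // mulrC.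
  (* No upcrossing fits below the bound 0. *)
  have [M0|M_gt0] := posnP M; last first.
    apply: le_trans (@bad_starts_count R d s t k M M.+1 Q j (fun i j => S i j w)
      d_gt0 d_lt1 Q_large k_gt0 M_gt0 jk) _.
    by rewrite -natrM ler_nat muln2 -addnn leq_add2l.
  rewrite (_ : [set i | _]%SET = finset.set0) ?cards0 ?mulr0 //.
  apply/setP => i; rewrite !inE; apply/asboolP => -[[a [b [a1 ab ba _ bM]]] _].
  by have := interlaced_ge a1 ab ba (_ : (1 <= k <= k)%N); lia.
move=> /(_ count); under eq_bigr do rewrite PF -/p pE.
rewrite sumEFin lee_fin sumr_const card_ord -[leLHS]mulr_natl.
by rewrite ler_pM2l ?ltr0n // pE lee_fin.
Qed.

Lemma bernoulli_ge (R : realFieldType) (x : R) n :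
  0 <= x -> x <= 1 -> 1 - n%:R * x <= (1 - x) ^+ n.
Proof.
move=> x0 x1; elim: n => [|n IH]; first by rewrite mul0r subr0.
rewrite exprSr; apply: (@le_trans _ _ ((1 - n%:R * x) * (1 - x))).
  rewrite -subr_ge0 -[n.+1]addn1 natrD.
  have -> : (1 - n%:R * x) * (1 - x) - (1 - (n%:R + 1) * x) = n%:R * (x * x) by ring.
  by rewrite mulr_ge0 // mulr_ge0.
by rewrite ler_wpM2r // subr_ge0.
Qed.

(** By Bernoulli's inequality [rho = 1 - (1 - g^-1) / n] will do. *)
Lemma root_rate (R : realFieldType) (g : R) n : 1 < g -> (0 < n)%N ->
  exists rho, [/\ 0 < rho, rho < 1 & g^-1 <= rho ^+ n].
Proof.
move=> g1 n0; have g0 : 0 < g by exact: lt_trans g1.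
have gi0 : 0 < g^-1 by rewrite invr_gt0.
have gi1 : g^-1 < 1 by rewrite invf_lt1.
pose x := (1 - g^-1) / n%:R.
have nx : n%:R * x = 1 - g^-1 by rewrite /x mulrC divfK // pnatr_eq0 -lt0n.
have x0 : 0 < x by rewrite divr_gt0 ?subr_gt0 ?ltr0n.
have x1 : x < 1.
  have : x <= n%:R * x by rewrite ler_peMl ?(ltW x0) // ler1n.
  by rewrite nx; lra.
exists (1 - x); split; [by rewrite subr_gt0|by rewrite gtrBl|].
by apply: le_trans (bernoulli_ge n (ltW x0) (ltW x1)); rewrite nx; lra.
Qed.

Lemma upcrosses_by_mono (R : realType) (x : nat -> R) (s t : R) k M M' :
  (M <= M')%N -> upcrosses_by x s t k M -> upcrosses_by x s t k M'.
Proof.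
by move=> MM' [a [b [? ? ? ? bM]]]; exists a, b; split=> //; exact: leq_trans bM MM'.
Qed.

Lemma has_upcrossings_bigcup (R : realType) (x : nat -> R) (s t : R) k :
  has_upcrossings x s t k <-> exists M, upcrosses_by x s t k M.
Proof.
split=> [[a [b [? ? ? ?]]]|[M [a [b [? ? ? ? _]]]]]; last by exists a, b.
by exists (b k), a, b.
Qed.

Lemma event_E_bigcup (R : realType) (T : Type) (S : nat -> nat -> T -> R)
    (d s t : R) k :
  event_E S d s t k = \bigcup_M [set w | low_filled_by (fun i j => S i j w) d s t k M].
Proof.
apply/seteqP; split=> [w [n [kn tn fill]]|w [M _ [n [/andP[kn _] tn fill]]]].
  by exists n => //; exists n; rewrite kn leqnn.
by exists n.
Qed.

(** Without the bound [M], this is a limit of increasing events; each of them is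
contained in the union of the event of a bad start and of [event_E]. *)
Lemma upcrossing_probability (R : realType) (d s t : R) (k Q j : nat)
    (disp : measure_display) (T : measurableType disp) (P : probability T R)
    (S : nat -> nat -> {RV P >-> R}) :
  stationary P S -> 0 < d -> d < 1 -> 32 / d ^+ 3 <= Q%:R -> (0 < k)%N ->
  (j * (Q + Q) <= uphalf k)%N ->
  (P [set w | has_upcrossings (fun n => S 1%N n w) s t k]
    <= (2 * (1 + d / 4) ^- j)%:E + P (event_E S d s t k))%E.
Proof.
move=> stat d_gt0 d_lt1 Q_large k_gt0 jk.
pose y w i j := S i j w.
pose H M := [set w | upcrosses_by (y w 1%N) s t k M].
have mH M : measurable (H M).
  exact: (array_measurable_event S (array_measurable_upcrosses s t k M)).
have mE : measurable (event_E S d s t k).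
  rewrite event_E_bigcup; apply: bigcupT_measurable => M.
  exact: (array_measurable_event S (array_measurable_low_filled d s t k M)).
have mB M : measurable [set w | bad_start (y w) d s t k M].
  exact: (array_measurable_event S (array_measurable_bad_start d s t k M)).
have -> : [set w | has_upcrossings (fun n => S 1%N n w) s t k] = \bigcup_M H M.
  apply/seteqP; split=> w.
    by move=> /has_upcrossings_bigcup[M ?]; exists M.
  by move=> [M _ ?]; apply/has_upcrossings_bigcup; exists M.
have mono : nondecreasing_seq H.
  by move=> M M' MM'; apply/subsetPset => w; exact: upcrosses_by_mono.
have cv := @nondecreasing_cvg_mu _ _ _ P H mH (bigcupT_measurable H mH) mono.
apply: (cvge_to_le cv).
apply: nearW => M /=.
have sub : H M `<=` [set w | bad_start (y w) d s t k M] `|` event_E S d s t k.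
  move=> w Hw; have [low|nlow] := pselect (low_filled_by (y w) d s t k M).
    by right; rewrite event_E_bigcup; exists M.
  by left; split.
have mU := measurableU _ _ (mB M) mE.
have leH := le_measure P (mem_set (mH M)) (mem_set mU) sub.
have leU : (P ([set w | bad_start (y w) d s t k M] `|` event_E S d s t k)
    <= P [set w | bad_start (y w) d s t k M] + P (event_E S d s t k))%E.
  exact: measureU2.
apply: (le_trans leH); apply: (le_trans leU).
by rewrite leeD2r // (bad_start_probability _ _ _ stat d_gt0 d_lt1 Q_large).
Qed.

Unset Implicit Arguments.
Theorem theorem1p1 (R : realType) (delta : R) (delta_gt0 : 0 < delta)
    (delta_lt : delta < 1 / 4) :
  exists c rho : R, [/\ 0 < rho, rho < 1 &
    forall (d : measure_display) (T : measurableType d) (P : probability T R)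
      (S : nat -> nat -> {RV P >-> R}),
      stationary P S ->
      forall s t : R, s < t ->
      forall k : nat, (0 < k)%N ->
        (P [set w | has_upcrossings (fun n => S 1%N n w) s t k]
         <= (c * rho ^+ k)%:E + P (event_E S delta s t k))%E].
Proof.
have d_lt1 : delta < 1 by lra.
(* With [eps = delta / 4] this makes [1 / (Q * eps * delta)] at most
   [delta / 8]. *)
pose Q := Num.bound (32 / delta ^+ 3).
have Q_large : 32 / delta ^+ 3 <= Q%:R.
  by apply/ltW/archi_boundP; rewrite divr_ge0 ?exprn_ge0 ?(ltW delta_gt0).
have Q_gt0 : (0 < Q)%N.
  by rewrite -(ltr_nat R); apply: lt_le_trans Q_large; rewrite divr_gt0 ?exprn_gt0.
have g1 : 1 < 1 + delta / 4 by lra.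
have [|rho [rho_gt0 rho_lt1 rhoP]] := @root_rate R _ (2 * (Q + Q)) g1.
  by rewrite muln_gt0 addn_gt0 Q_gt0.
exists (2 * (1 + delta / 4)), rho; split=> // d T P S stat s t _ k k_gt0.
pose j := (uphalf k %/ (Q + Q))%N.
have jk : (j * (Q + Q) <= uphalf k)%N by exact: leq_trunc_div.
have := @upcrossing_probability R delta s t k Q j d T P S stat delta_gt0 d_lt1
  Q_large k_gt0 jk.
move=> /le_trans; apply; rewrite leeD2r // lee_fin -mulrA ler_pM2l //.
(* The rounding in [j] costs at most one round, whence the factor
   [1 + delta / 4] in the constant. *)
have kj : (k <= 2 * (Q + Q) * j.+1)%N.
  have : (uphalf k < j.+1 * (Q + Q))%N by rewrite ltn_ceil // addn_gt0 Q_gt0.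
  by have := uphalf_half k; have := odd_double_half k; lia.
have g0 : 0 < 1 + delta / 4 by lra.
rewrite -ler_pdivrMl // -invfM -exprS -exprVn.
apply: (@le_trans _ _ (rho ^+ (2 * (Q + Q) * j.+1))).
  rewrite exprM; apply: lerXn2r; last exact: rhoP.
    by rewrite nnegrE invr_ge0 ltW.
  by rewrite nnegrE exprn_ge0 // ltW.
by apply: ler_wiXn2l => //; exact: ltW.
Qed.
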